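(* Let $R$ be a semiprime left Goldie ring. Then there is a bijective correspondence between a complete set of representatives of isomorphism classes of indecomposable nonsingular injective $R$-modules and the set of minimal prime ideals of $R$.
   Context: $R$ is an associative ring with unity and $R$-modules are unitary left $R$-modules; singularity is that of left modules. $R$ is left Goldie if it satisfies ACC on left annihilators and has finite uniform dimension as a left $R$-module. *)

(* Defs.v *)
From HB Require Import structures.
From mathcomp Require Import all_boot all_algebra.
From mathcomp Require Import all_classical.

Set Implicit Arguments.
Unset Strict Implicit.
Unset Printing Implicit Defensive.

Import GRing.Theory.
Local Open Scope classical_set_scope.
Local Open Scope ring_scope.

(* Rings are [pzRingType]s: associative with unity, not assumed commutative;
   the zero ring is allowed.  [lmodType R] is the type of unitary left
   R-modules, and [R^o] is R as a left module over itself. *)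

Section Modules.
Variable R : pzRingType.
Implicit Types M N : lmodType R.

Definition submodule M (A : set M) : Prop := GRing.submod_closed [in A].

Definition nonzero_submodule M (A : set M) : Prop :=
  submodule A /\ A != [set 0].

Definition essential M (A : set M) : Prop :=
  submodule A /\
  forall B : set M, nonzero_submodule B -> A `&` B != [set 0].

Definition uniform_submodule M (U : set M) : Prop :=
  nonzero_submodule U /\
  forall A B : set M, nonzero_submodule A -> nonzero_submodule B ->
    A `<=` U -> B `<=` U -> A `&` B != [set 0].

Definition submodule_sum M n (U : 'I_n -> set M) : set M :=
  [set x | exists2 u : 'I_n -> M, forall i, U i (u i) & x = \sum_i u i].

Definition independent M n (U : 'I_n -> set M) : Prop :=
  forall u : 'I_n -> M,
    (forall i, U i (u i)) -> \sum_i u i = 0 -> forall i, u i = 0.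

Definition has_uniform_dimension M (n : nat) : Prop :=
  exists U : 'I_n -> set M,
    [/\ forall i, uniform_submodule (U i),
        independent U & essential (submodule_sum U)].

Definition finite_uniform_dimension M : Prop :=
  exists n, has_uniform_dimension M n.

Definition annihilator M (x : M) : set R^o := [set r : R | r *: x = 0].

Definition singular_submodule M : set M :=
  [set x | essential (annihilator x)].

Definition nonsingular M : Prop := @singular_submodule M = [set 0].

Definition indecomposable M : Prop :=
  (exists x : M, x != 0) /\
  forall A B : set M, submodule A -> submodule B ->
    A `&` B = [set 0] -> (forall x, exists2 a, A a & exists2 b, B b & x = a + b) ->
    A = [set 0] \/ B = [set 0].

Definition injective_module (E : lmodType R) : Prop :=
  forall (M N : lmodType R) (i : {linear M -> N}) (f : {linear M -> E}),
    injective i -> exists g : {linear N -> E}, forall x, g (i x) = f x.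

Definition isomorphic M N : Prop := exists f : {linear M -> N}, bijective f.

Definition complete_representatives (C : lmodType R -> Prop)
    (I : Type) (E : I -> lmodType R) : Prop :=
  [/\ forall i, C (E i),
      forall i j, isomorphic (E i) (E j) -> i = j &
      forall M, C M -> exists i, isomorphic M (E i)].

Definition indecomposable_nonsingular_injective M : Prop :=
  [/\ indecomposable M, nonsingular M & injective_module M].

End Modules.

Section Rings.
Variable R : pzRingType.
Implicit Types A B P : set R.

Definition left_annihilator (X : set R) : set R :=
  [set r | forall x, X x -> r * x = 0].

Definition is_left_annihilator A : Prop := exists X, A = left_annihilator X.

Definition acc_left_annihilators : Prop :=
  forall u : nat -> set R,
    (forall n, is_left_annihilator (u n)) ->
    (forall n, u n `<=` u n.+1) ->
    exists N, forall n, (N <= n)%N -> u n = u N.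

Definition left_Goldie : Prop :=
  acc_left_annihilators /\ finite_uniform_dimension R^o.

Definition two_sided_ideal A : Prop :=
  submodule (A : set R^o) /\ forall a r : R, A a -> A (a * r).

Definition ideal_mul A B : set R :=
  [set x | exists n (a b : 'I_n -> R),
    (forall i, A (a i) /\ B (b i)) /\ x = \sum_i a i * b i].

Definition prime_ideal P : Prop :=
  [/\ two_sided_ideal P, P != setT &
      forall A B, two_sided_ideal A -> two_sided_ideal B ->
        ideal_mul A B `<=` P -> A `<=` P \/ B `<=` P].

Definition minimal_prime_ideal P : Prop :=
  prime_ideal P /\ forall Q, prime_ideal Q -> Q `<=` P -> Q = P.

Definition semiprime_ideal P : Prop :=
  two_sided_ideal P /\
  forall A, two_sided_ideal A -> ideal_mul A A `<=` P -> A `<=` P.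

Definition semiprime_ring : Prop := semiprime_ideal [set 0].

End Rings.

(* Main.v *)
Require Import Defs.
From HB Require Import structures.
From mathcomp Require Import all_boot all_algebra.
From mathcomp Require Import all_classical.

(** The correspondence sends an indecomposable nonsingular injective module E
to its annihilator Ann E in R.

A complement argument shows that every nonzero submodule of such an E is
essential ([indecomposable_injective_essential]).  In a semiprime ring a
two-sided ideal I together with its left annihilator spans an essential left
ideal ([ideal_add_annihilator_essential]), so a two-sided ideal killing an
essential submodule of a nonsingular module kills the whole module
([essential_annihilator_sub]).  Hence Ann E is the annihilator of every nonzero
submodule of E, which makes it prime; and it is minimal, since a prime Q
strictly below Ann E would contain the left annihilator of Ann E, forcing that
annihilator to vanish, Ann E to be essential and E to be singular ([annihilator_minimal_prime]).

The annihilator determines E: as E is nonsingular, some y = t x in E has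
l(y) = l(t), where l denotes the left annihilator in R.  If Ann E' is contained
in Ann E, then t does not kill E', so z = t e' is nonzero for some e', and
r y |-> r z is well defined.  It extends to a map E -> E', which is injective
because E is uniform and E' nonsingular, and bijective because E is injective
and E' indecomposable ([annihilator_sub_isomorphic]).

Every minimal prime P occurs.  The ascending chain condition makes R left
nonsingular ([acc_semiprime_nonsingular]).  Let U_1, ..., U_n be independent
uniform left ideals with essential sum, and E_i the injective hull of U_i; it is
indecomposable because U_i is uniform.  If r lies in all the Ann E_i, then
r (U_1 + ... + U_n) = 0, hence r = 0 by semiprimeness.  The finite intersection
of the Ann E_i being contained in P, some Ann E_i is, and minimality gives
equality ([minimal_prime_annihilator]).

The hull of a nonsingular module M over a left nonsingular ring is built as the
module of germs: linear maps from essential left ideals to M, two of them being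
identified when they agree on an essential left ideal
([nonsingular_injective_hull]). *)

Set Implicit Arguments.
Unset Strict Implicit.
Unset Printing Implicit Defensive.

Import GRing.Theory.
Local Open Scope classical_set_scope.
Local Open Scope ring_scope.

(** * Essential submodules and complements *)

Section Submodules.
Variable R : pzRingType.
Implicit Types M N : lmodType R.

Lemma submoduleP M (A : set M) :
  submodule A <->
  A 0 /\ forall (a : R) x y, A x -> A y -> A (a *: x + y).
Proof.
rewrite /submodule; split=> [[A0 AL]|[A0 AL]]; split.
- by rewrite inE in A0.
- by move=> a x y Ax Ay; have := AL a x y; rewrite !inE; apply.
- by rewrite inE.
- by move=> a x y; rewrite !inE; apply: AL.
Qed.

Section Closure.
Variables (M : lmodType R) (A : set M).
Hypothesis hA : submodule A.

Lemma submod0 : A 0.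
Proof. by case/submoduleP: hA. Qed.

Lemma submodD x y : A x -> A y -> A (x + y).
Proof. by case/submoduleP: hA => _ h Ax Ay; rewrite -[x]scale1r; apply: h. Qed.

Lemma submodZ (a : R) x : A x -> A (a *: x).
Proof.
by case/submoduleP: hA => A0 h Ax; rewrite -[_ *: _]addr0; apply: h.
Qed.

Lemma submodB x y : A x -> A y -> A (x - y).
Proof.
by move=> Ax Ay; apply: submodD => //; rewrite -scaleN1r; apply: submodZ.
Qed.

Lemma submod_neq0P : A != [set 0] <-> exists2 x, A x & x != 0.
Proof.
split=> [/eqP nA|[x Ax /eqP nx]]; last first.
  by apply/eqP => A0; apply: nx; rewrite A0 in Ax.
apply: contrapT => h; apply: nA; apply/seteqP; split=> [x Ax|_ ->];
  last exact: submod0.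
by apply: contrapT => nx; apply: h; exists x => //; apply/eqP.
Qed.

End Closure.

Definition multiples M (x : M) : set M := [set r *: x | r in [set: R]].

Lemma submodule_multiples M (x : M) : submodule (multiples x).
Proof.
apply/submoduleP; split; first by exists 0 => //; rewrite scale0r.
move=> a _ _ [r _ <-] [s _ <-]; exists (a * r + s) => //.
by rewrite scalerDl scalerA.
Qed.

Lemma multiples_id M (x : M) : multiples x x.
Proof. by exists 1 => //; rewrite scale1r. Qed.

Lemma submoduleI M (A B : set M) :
  submodule A -> submodule B -> submodule (A `&` B).
Proof.
move=> hA hB; apply/submoduleP; split; first by split; apply: submod0.
by move=> a x y [? ?] [? ?]; split; apply: submodD => //; apply: submodZ.
Qed.

Definition colon M (A : set M) (x : M) : set R^o := [set r : R | A (r *: x)].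

Lemma submodule_colon M (A : set M) x : submodule A -> submodule (colon A x).
Proof.
move=> hA; apply/submoduleP; split.
  by rewrite /colon /= scale0r; apply: submod0.
move=> a r s Ar As; rewrite /colon /= scalerDl.
by apply: submodD => //; rewrite -scalerA; apply: submodZ.
Qed.

Lemma submodule_annihilator M (x : M) : submodule (annihilator x).
Proof.
apply/submoduleP; rewrite /annihilator; split=> /=; first by rewrite scale0r.
by move=> a r s r0 s0; rewrite scalerDl -scalerA r0 s0 scaler0 addr0.
Qed.

(** Testing against cyclic submodules is enough, since every nonzero submodule
contains one; this reduces all later essentiality arguments to elements. *)
Lemma essentialP M (A : set M) :
  essential A <->
  submodule A /\ forall x, x != 0 -> exists2 r : R, A (r *: x) & r *: x != 0.
Proof.
split=> [[hA eA]|[hA eA]]; split=> //.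
  move=> x nx; have hx := submodule_multiples x.
  have /eA/(submod_neq0P (submoduleI hA hx))[y [Ay [r _ yE]] ny] :
      nonzero_submodule (multiples x).
    split=> //; apply/(submod_neq0P hx).
    by exists x => //; apply: multiples_id.
  by exists r; rewrite yE.
move=> B [hB /(submod_neq0P hB)[x Bx /eA[r Ar nr]]].
apply/(submod_neq0P (submoduleI hA hB)); exists (r *: x) => //.
by split=> //; apply: submodZ.
Qed.

Lemma essential_setT M : essential [set: M].
Proof.
apply/essentialP; split; first by apply/submoduleP.
by move=> x nx; exists 1; rewrite ?scale1r.
Qed.

Lemma essential_sub M (A B : set M) :
  submodule B -> A `<=` B -> essential A -> essential B.
Proof.
move=> hB AB /essentialP[_ eA]; apply/essentialP; split=> // x /eA[r Ar nr].
by exists r => //; apply: AB.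
Qed.

Lemma essentialI M (A B : set M) :
  essential A -> essential B -> essential (A `&` B).
Proof.
move=> /essentialP[hA eA] /essentialP[hB eB]; apply/essentialP.
split; first exact: submoduleI.
move=> x /eA[r Ar /eB[s Bs ns]]; exists (s * r); rewrite -scalerA //.
by split=> //; apply: submodZ.
Qed.

Lemma essential_colon M (A : set M) x : essential A -> essential (colon A x).
Proof.
move=> /essentialP[hA eA]; apply/essentialP; split; first exact: submodule_colon.
move=> b nb; have [bx0|nbx] := eqVneq ((b : R) *: x) 0.
  by exists 1; rewrite /colon /= ?scale1r // bx0; apply: submod0.
have [r Ar nr] := eA _ nbx; exists r; rewrite /colon /=.
  by rewrite -scalerA.
apply: contra_neq nr => rb0; rewrite scalerA.
by rewrite (_ : r * b = 0) ?scale0r.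
Qed.

Lemma nonsingularP M :
  nonsingular M <->
  forall (L : set R^o) (x : M),
    essential L -> (forall r : R, L r -> r *: x = 0) -> x = 0.
Proof.
split=> [ns L x eL Lx|h].
  suff: singular_submodule x by rewrite ns.
  by apply: essential_sub eL => //; apply: submodule_annihilator.
apply/seteqP; split=> [x ex|_ ->].
  by apply: (h _ x ex) => r.
apply: essential_sub (essential_setT _); first exact: submodule_annihilator.
by move=> r _; rewrite /annihilator /= scaler0.
Qed.

(** The form in which nonsingularity is used below: an equation may be checked
after multiplication by an essential left ideal. *)
Lemma nonsingular_eq M (L : set R^o) (x y : M) :
  nonsingular M -> essential L ->
  (forall r : R, L r -> r *: x = r *: y) -> x = y.
Proof.
move=> /nonsingularP ns eL xy; apply/eqP; rewrite -subr_eq0; apply/eqP.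
by apply: (ns _ _ eL) => r Lr; rewrite scalerBr xy // subrr.
Qed.

Lemma nonsingular_inj M N (i : {linear M -> N}) :
  injective i -> nonsingular N -> nonsingular M.
Proof.
move=> ii /nonsingularP ns; apply/nonsingularP => L x eL Lx; apply: ii.
rewrite linear0; apply: (ns _ _ eL) => r Lr.
by rewrite -linearZ /= Lx // linear0.
Qed.

Definition pair_sum M (A B : set M) : set M :=
  [set x | exists2 a, A a & B (x - a)].

Lemma submodule_pair_sum M (A B : set M) :
  submodule A -> submodule B -> submodule (pair_sum A B).
Proof.
move=> hA hB; apply/submoduleP; split.
  by exists 0; rewrite ?subr0; apply: submod0.
move=> r x y [a Aa Bx] [b Ab By]; exists (r *: a + b).
  by apply: submodD => //; apply: submodZ.
by rewrite opprD addrACA -scalerBr; apply: submodD => //; apply: submodZ.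
Qed.

(** By Zorn's lemma there is a submodule C maximal among those meeting A in 0;
if some nonzero Rx met A + C in 0, then C + Rx would be larger. *)
Lemma essential_complement M (A : set M) : submodule A ->
  exists C : set M, [/\ submodule C, A `&` C `<=` [set 0] &
    essential (pair_sum A C)].
Proof.
move=> hA.
(* The empty set is admitted because it is the union of the empty chain. *)
pose P (C : set M) := (C = set0 \/ submodule C) /\ A `&` C `<=` [set 0].
have /Zorn_bigcup[C [[[C0|hC] AC0] maxC]] : forall F : set (set M),
    F `<=` P -> total_on F subset -> P (\bigcup_(X in F) X).
  move=> F PF totF.
  split; last by move=> x [Ax [C FC Cx]]; case: (PF C FC) => _; apply.
  have [FE|/existsNP[C /not_implyP[FC nC]]] :=
      pselect (forall C, F C -> C = set0).
    by left; apply/seteqP; split=> // x [C /FE ->].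
  right.
  have hF D : F D -> D !=set0 -> submodule D.
    by move=> FD [x Dx]; case: (PF D FD) => -[D0|//]; rewrite D0 in Dx.
  have /set0P C0 : C != set0 by apply/eqP.
  apply/submoduleP; split; first by exists C => //; apply: submod0; apply: hF.
  move=> a x y [D FD Dx] [D' FD' Dy].
  have hD : submodule D by apply: hF FD _; exists x.
  have hD' : submodule D' by apply: hF FD' _; exists y.
  case: (totF D D' FD FD') => DD; [exists D' => //|exists D => //].
    by apply: submodD => //; apply: submodZ => //; apply: DD.
  by apply: submodD => //; [apply: submodZ|apply: DD].
- (* The zero submodule properly contains the empty set. *)
  case: (maxC [set 0]).
    by rewrite C0; split=> // /(_ 0 erefl).
  split; last by move=> x [].
  right; apply/submoduleP; split=> // a x y -> ->.
  by rewrite /= scaler0 addr0.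
- exists C; split=> //; apply/essentialP; split; first exact: submodule_pair_sum.
  move=> x nx; apply: contrapT => h.
  have hx r : pair_sum A C (r *: x) -> r *: x = 0.
    by move=> Hr; apply: contrapT => nr; apply: h; exists r => //; apply/eqP.
  pose C' := pair_sum C (multiples x).
  have hC' : submodule C'.
    by apply: submodule_pair_sum => //; apply: submodule_multiples.
  have CC' : C `<=` C'.
    move=> c Cc; exists c => //; rewrite subrr.
    exact: submod0 (submodule_multiples x).
  case: (maxC C'); last first.
    split; first by right.
    move=> a [Aa [c Cc [r _ rE]]]; apply: AC0; split=> //.
    suff r0 : r *: x = 0 by move: rE; rewrite r0 => /esym/subr0_eq ->.
    apply: hx; rewrite rE; exists a => //.
    by rewrite addrAC subrr add0r -sub0r; apply: submodB => //; apply: submod0.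
  split=> // CC; apply/negP: nx; rewrite negbK -[x]scale1r; apply/eqP/hx.
  exists 0; first exact: submod0.
  rewrite scale1r subr0; apply: CC; exists 0; first exact: submod0.
  by rewrite subr0; apply: multiples_id.
Qed.

Definition linear_on M N (A : set M) (phi : M -> N) : Prop :=
  forall (a : R) x y, A x -> A y -> phi (a *: x + y) = a *: phi x + phi y.

(** Since A and C meet in 0, the A-component of an element of A + C is unique,
so phi composed with the projection to A is well defined. *)
Lemma extend_by_zero M N (A C : set M) (phi : M -> N) :
  submodule A -> submodule C -> A `&` C `<=` [set 0] -> linear_on A phi ->
  exists psi : M -> N, [/\ linear_on (pair_sum A C) psi,
    forall x, A x -> psi x = phi x & forall x, C x -> psi x = 0].
Proof.
move=> hA hC AC0 lphi.
have [p pP] : {p : M -> M & forall x, pair_sum A C x -> A (p x) /\ C (x - p x)}.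
  apply: (@choice _ _ (fun x a => pair_sum A C x -> A a /\ C (x - a))) => x.
  have [[a Aa Ca]|nx] := pselect (pair_sum A C x); last by exists 0.
  by exists a.
have pE x a : A a -> C (x - a) -> p x = a.
  move=> Aa Ca; have [Ap Cp] : A (p x) /\ C (x - p x) by apply: pP; exists a.
  apply/eqP; rewrite -subr_eq0; apply/eqP; apply: AC0; split; first exact: submodB.
  rewrite (_ : p x - a = (x - a) - (x - p x)); first exact: submodB.
  by rewrite opprB [RHS]addrC addrA addrNK.
have phi0 : phi 0 = 0.
  have := lphi (-1) 0 0 (submod0 hA) (submod0 hA).
  by rewrite scaler0 addr0 scaleN1r addNr.
exists (phi \o p); split=> [a x y /pP[Ax Cx] /pP[Ay Cy]|x Ax|x Cx] /=.
- rewrite -lphi //; congr phi; apply: pE.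
    by apply: submodD => //; apply: submodZ.
  by rewrite opprD addrACA -scalerBr; apply: submodD => //; apply: submodZ.
- by congr phi; apply: pE => //; rewrite subrr; apply: submod0.
- by rewrite (pE x 0) ?subr0 //; apply: submod0.
Qed.

Lemma linear_on_setT M N (A : set M) (phi : M -> N) :
  (forall x, A x) -> linear_on A phi ->
  exists g : {linear M -> N}, forall x, g x = phi x.
Proof.
move=> AT lphi; have l : linear phi by move=> a x y; apply: lphi.
pose lm := GRing.isLinear.Build R M N _ phi l.
by pose g : {linear M -> N} := HB.pack phi lm; exists g.
Qed.

End Submodules.

Section SubmoduleType.
Variables (R : pzRingType) (N : lmodType R) (A : set N) (hA : submodule A).

Definition submod_pred (_ : submodule A) : {pred N} := [in A].
HB.instance Definition _ := GRing.isSubmodClosed.Build R N (submod_pred hA)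
  (GRing.submod_closed_semi hA).

Definition submod_type (h : submodule A) := {x : N | x \in submod_pred h}.
HB.instance Definition _ := SubChoice.on (submod_type hA).
HB.instance Definition _ :=
  [SubChoice_isSubLmodule of submod_type hA by <:].

(** Injectivity quantifies over modules, not submodules; this lemma is the
passage from the latter to the former. *)
Lemma submodule_as_module :
  exists (M : lmodType R) (i : {linear M -> N}),
    injective i /\ range i = A.
Proof.
exists (submod_type hA : lmodType R), (\val : {linear submod_type hA -> N}).
split; first exact: val_inj.
apply/seteqP; split=> [_ [x _ <-]|x Ax].
  by have := valP x; rewrite unfold_in /= inE.
by exists (Sub x (introT (asboolP _) Ax)).
Qed.

End SubmoduleType.

(** * Nonsingular injective modules and their annihilators *)

Section Injectives.
Variable R : pzRingType.
Implicit Types M N E : lmodType R.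

(** Injectivity restated for partial maps defined on a submodule. *)
Lemma injective_extend E N (A : set N) (phi : N -> E) :
  injective_module E -> submodule A -> linear_on A phi ->
  exists g : {linear N -> E}, forall x, A x -> g x = phi x.
Proof.
move=> injE hA lphi; have [M [i [ii iA]]] := submodule_as_module hA.
have Ai x : A (i x) by rewrite -iA; exists x.
have [f fE] : exists f : {linear M -> E}, forall x, f x = phi (i x).
  apply: (@linear_on_setT _ _ _ [set: M] (phi \o i)) => // a x y _ _ /=.
  by rewrite linearP lphi.
have [g gE] := injE M N i f ii; exists g => x.
by rewrite -{1}iA => -[y _ <-]; rewrite gE fE.
Qed.

(** A variant of Baer's criterion for essential left ideals.  A map from a
submodule extends by zero along a complement, hence to an essential submodule B.
For n in N the left ideal (B : n) is essential, so r |-> psi (r n) is right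
multiplication by some g n, unique by nonsingularity; uniqueness makes g
linear. *)
Lemma nonsingular_injective_criterion E : nonsingular E ->
  (forall (L : set R^o) (phi : R^o -> E), essential L -> linear_on L phi ->
    exists q : E, forall r : R, L r -> phi r = r *: q) ->
  injective_module E.
Proof.
move=> nsE critE M N i f ii.
pose A : set N := range i.
have hA : submodule A.
  apply/submoduleP; split; first by exists 0; rewrite ?linear0.
  by move=> a _ _ [x _ <-] [y _ <-]; exists (a *: x + y); rewrite ?linearP.
have [p pE] : {p : N -> M & forall n, A n -> i (p n) = n}.
  apply: (@choice _ _ (fun n m => A n -> i m = n)) => n.
  by have [[m _ <-]|nA] := pselect (A n); [exists m | exists 0].
have pi m : p (i m) = m by apply: ii; rewrite pE //; exists m.
have [C [hC AC0 eB]] := essential_complement hA.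
have lfp : linear_on A (f \o p).
  by move=> a _ _ [x _ <-] [y _ <-] /=; rewrite -linearP !pi linearP.
have [psi [lpsi psiA _]] := extend_by_zero hA hC AC0 lfp.
set B := pair_sum A C in eB lpsi.
have [g gE] : {g : N -> E &
    forall n (r : R), B (r *: n) -> psi (r *: n) = r *: g n}.
  apply: (@choice _ _ (fun n q =>
    forall r : R, B (r *: n) -> psi (r *: n) = r *: q)) => n.
  apply: (critE (colon B n) (fun r : R => psi (r *: n))).
    exact: essential_colon.
  by move=> a x y Bx By; rewrite scalerDl -scalerA lpsi.
have lg : linear_on [set: N] g.
  move=> a x y _ _.
  have eL := essentialI (essential_colon (a *: x) eB) (essential_colon y eB).
  apply: (nonsingular_eq nsE eL) => r [rx ry].
  rewrite -gE; last by rewrite scalerDr; apply: submodD => //; case: eB.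
  rewrite scalerDr -[r *: (a *: x)]scale1r lpsi // scale1r.
  by rewrite scalerDr -(gE y) // [in RHS]scalerA -(gE x) -?scalerA.
have [h hE] := linear_on_setT (fun _ => I) lg.
exists h => x; rewrite hE.
have Ax : A (i x) by exists x.
have Bx : B (i x) by exists (i x) => //; rewrite subrr; apply: submod0.
by have := gE (i x) 1; rewrite !scale1r => /(_ Bx) <-; rewrite psiA //= pi.
Qed.

(** If C is a complement of A, the projection A + C -> A extends to e : E -> E.
It is idempotent on an essential submodule, hence everywhere by nonsingularity,
so E splits as im e + ker e with A inside im e and C inside ker e; thus C = 0
and A = A + C is essential. *)
Lemma indecomposable_injective_essential E (A : set E) :
  indecomposable_nonsingular_injective E ->
  nonzero_submodule A -> essential A.
Proof.
move=> [[_ indE] nsE injE] [hA nA].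
have [C [hC AC0 eB]] := essential_complement hA.
have [psi [lpsi psiA psiC]] :
    exists psi : E -> E, [/\ linear_on (pair_sum A C) psi,
      forall x, A x -> psi x = x & forall x, C x -> psi x = 0].
  by apply: (extend_by_zero hA hC AC0).
have hB : submodule (pair_sum A C) by case: eB.
have [e eE] := injective_extend injE hB lpsi.
have BA x : A x -> pair_sum A C x.
  by move=> Ax; exists x => //; rewrite subrr; apply: submod0.
have BC x : C x -> pair_sum A C x.
  by move=> Cx; exists 0; rewrite ?subr0 //; apply: submod0.
have eA x : A x -> e x = x by move=> Ax; rewrite eE ?psiA //; apply: BA.
have eC x : C x -> e x = 0 by move=> Cx; rewrite eE ?psiC //; apply: BC.
have ee x : e (e x) = e x.
  apply: (nonsingular_eq nsE (essential_colon x eB)) => r [a Aa Ca].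
  have erx : e (r *: x) = a.
    by have := eC _ Ca; rewrite linearB /= (eA _ Aa) => /subr0_eq.
  by rewrite -!linearZ /= erx eA.
have hK : submodule [set x | e x = 0].
  apply/submoduleP; split=> [|a x y /= ex ey]; first exact: (linear0 e).
  by rewrite linearP ex ey scaler0 addr0.
have hI : submodule [set x | e x = x].
  apply/submoduleP; split=> [|a x y /= ex ey]; first exact: (linear0 e).
  by rewrite linearP ex ey.
case: (indE _ _ hI hK) => [||I0|K0].
- apply/seteqP; split=> [x [/= ex ex0]|_ ->] /=; first by rewrite -ex.
  by split; rewrite /= linear0.
- move=> x; exists (e x); first exact: ee.
  by exists (x - e x); rewrite /= ?linearB /= ?ee ?subrr // addrC subrK.
- have /(submod_neq0P hA)[x Ax /eqP[]] := nA.
  by rewrite -[x = 0]/([set 0] x) -I0 /= eA.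
- apply: essential_sub eB => // x [a Aa Ca].
  suff /eqP : x - a = 0 by rewrite subr_eq0 => /eqP ->.
  by rewrite -[_ = 0]/([set 0] _) -K0 /= eC.
Qed.

(** A nonzero kernel would be essential, and the image would be singular. *)
Lemma uniform_hom_injective E E' (g : {linear E -> E'}) :
  indecomposable_nonsingular_injective E -> nonsingular E' ->
  (exists x, g x != 0) -> injective g.
Proof.
move=> iE /nonsingularP nsE' [z nz].
have hK : submodule [set x | g x = 0].
  apply/submoduleP; split=> [|a x y /= ex ey]; first exact: linear0.
  by rewrite linearP ex ey scaler0 addr0.
have K0 x : g x = 0 -> x = 0.
  move=> gx; apply: contrapT => /eqP nx; case/eqP: nz.
  have eK : essential [set x | g x = 0].
    apply: indecomposable_injective_essential => //; split=> //.
    by apply/(submod_neq0P hK); exists x.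
  by apply: (nsE' _ _ (essential_colon z eK)) => r; rewrite -linearZ.
move=> x y gxy; apply/eqP; rewrite -subr_eq0; apply/eqP/K0.
by rewrite linearB /= gxy subrr.
Qed.

(** The image of g is a nonzero direct summand of an indecomposable module. *)
Lemma injective_hom_bijective E E' (g : {linear E -> E'}) :
  injective_module E -> indecomposable E' -> (exists x, g x != 0) ->
  injective g -> bijective g.
Proof.
move=> injE [_ indE'] [x0 nx0] ig.
have [h hg] := injE _ _ g idfun ig.
have hI : submodule (range g).
  apply/submoduleP; split; first by exists 0; rewrite ?linear0.
  by move=> a _ _ [x _ <-] [y _ <-]; exists (a *: x + y); rewrite ?linearP.
have hK : submodule [set x | h x = 0].
  apply/submoduleP; split=> [|a x y /= ex ey]; first exact: linear0.
  by rewrite linearP ex ey scaler0 addr0.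
case: (indE' _ _ hI hK) => [||I0|K0].
- apply/seteqP; split=> [_ [[x _ <-]] /= |_ ->] /=.
    by rewrite hg /= => ->; rewrite linear0.
  by split; [exists 0 | ]; rewrite ?linear0.
- move=> y; exists (g (h y)); first by exists (h y).
  by exists (y - g (h y)); rewrite /= ?linearB /= ?hg ?subrr // addrC subrK.
- case/eqP: nx0; rewrite -[_ = 0]/([set 0] _) -I0; by exists x0.
- exists h => // y; apply/esym/eqP; rewrite -subr_eq0; apply/eqP.
  by rewrite -[_ = 0]/([set 0] _) -K0 /= linearB /= hg subrr.
Qed.

Definition module_annihilator M : set R := [set r | forall x : M, r *: x = 0].

Lemma two_sided_ideal_annihilator M : two_sided_ideal (module_annihilator M).
Proof.
split.
  apply/submoduleP; split=> [x|a r s r0 s0 x]; first exact: scale0r.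
  by rewrite scalerDl -scalerA r0 s0 scaler0 addr0.
by move=> a r ra x; rewrite -scalerA ra.
Qed.

Lemma module_annihilator_iso M N :
  isomorphic M N -> module_annihilator M = module_annihilator N.
Proof.
move=> [f [g gK fK]]; apply/seteqP; split=> r rM x.
  by rewrite -[x]fK -linearZ /= rM linear0.
by apply: (can_inj gK); rewrite linearZ /= rM linear0.
Qed.

(** The element y = t x has the annihilator of t, so any z = t e' receives a map
from R y; t does not kill E' because it does not kill E. *)
Lemma annihilator_sub_isomorphic E E' :
  indecomposable_nonsingular_injective E ->
  indecomposable_nonsingular_injective E' ->
  module_annihilator E' `<=` module_annihilator E -> isomorphic E E'.
Proof.
move=> iE iE' sub.
have [[[x nx] _] nsE injE] := iE; have [indE' nsE' injE'] := iE'.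
(* The annihilator of x is not essential: it misses some nonzero R t. *)
have [t [nt Jt]] : exists t : R, t *: x != 0 /\
    forall r : R, r *: (t *: x) = 0 -> r * t = 0.
  apply: contrapT => h; case/eqP: nx.
  move/nonsingularP: nsE; apply; last by move=> r; apply.
  apply/essentialP; split; first exact: (submodule_annihilator x).
  move=> t nt; apply: contrapT => nr.
  have Jt (r : R) : r *: ((t : R) *: x) = 0 -> r * t = 0.
    move=> rtx; apply: contrapT => /eqP nrt; apply: nr; exists r => //.
    by rewrite /annihilator /= -[RHS]rtx scalerA.
  apply: h; exists t; split=> //; apply: contra_neq nt => tx0.
  by rewrite -[t]mul1r; apply: Jt; rewrite scale1r.
have [e' ne'] : exists e' : E', t *: e' != 0.
  apply: contrapT => h; case/eqP: nt; apply: sub => y.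
  apply: contrapT => /eqP ny.
  by apply: h; exists y.
pose y := t *: x; pose z := t *: e'.
have yz (r : R) : r *: y = 0 -> r *: z = 0.
  by move=> /Jt rt; rewrite scalerA rt scale0r.
have [c cE] : {c : E -> R & forall v, multiples y v -> v = c v *: y}.
  apply: (@choice _ _ (fun v r => multiples y v -> v = r *: y)) => v.
  by have [[r _ <-]|nv] := pselect (multiples y v); [exists r | exists 0].
have lphi : linear_on (multiples y) (fun v => c v *: z).
  move=> a u v uy vy; rewrite scalerA -scalerDl.
  apply/eqP; rewrite -subr_eq0 -scalerBl; apply/eqP/yz.
  rewrite scalerBl scalerDl -scalerA -!cE ?subrr //.
  by case/submoduleP: (submodule_multiples y) => _; apply.
have [g gE] := injective_extend injE' (submodule_multiples y) lphi.
have gy : g y = z.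
  rewrite gE; last exact: multiples_id.
  apply/eqP; rewrite -subr_eq0 -[X in _ - X]scale1r -scalerBl; apply/eqP/yz.
  by rewrite scalerBl scale1r -cE ?subrr //; exact: multiples_id.
have ng : exists x, g x != 0 by exists y; rewrite gy.
exists g; apply: injective_hom_bijective => //.
exact: uniform_hom_injective.
Qed.

End Injectives.

(** * Semiprime rings *)

Section SemiprimeRings.
Variable R : pzRingType.
Implicit Types (M E : lmodType R) (I J P : set R).

Section TwoSided.
Variable I : set R.
Hypothesis hI : two_sided_ideal I.

Lemma ideal_mulr a r : I a -> I (a * r).
Proof. by case: hI => _; apply. Qed.

Lemma ideal_mull r a : I a -> I (r * a).
Proof. by case: hI => hl _; apply: (submodZ hl r). Qed.

End TwoSided.

Lemma left_annihilator_submodule (X : set R) :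
  submodule (left_annihilator X : set R^o).
Proof.
apply/submoduleP; split=> [x Xx|a r s r0 s0 x Xx]; first by rewrite mul0r.
by rewrite mulrDl -[_ *: _]/(a * r) -mulrA r0 // s0 // mulr0 addr0.
Qed.

Lemma left_annihilator_ideal (X : set R) :
  (forall r x, X x -> X (r * x)) -> two_sided_ideal (left_annihilator X).
Proof.
move=> hX; split; first exact: left_annihilator_submodule.
by move=> a r a0 x Xx; rewrite -mulrA a0 //; apply: hX.
Qed.

Lemma ideal_mul_sub (A B C : set R) : submodule (C : set R^o) ->
  (forall a b, A a -> B b -> C (a * b)) -> ideal_mul A B `<=` C.
Proof.
move=> hC ABC _ [n [a [b [AB ->]]]].
elim/big_ind: _ => [|x y|i _]; [exact: (submod0 hC)|exact: (submodD hC)|].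
by apply: ABC; case: (AB i).
Qed.

Lemma ideal_mul_mem (A B : set R) a b : A a -> B b -> ideal_mul A B (a * b).
Proof.
move=> Aa Bb; exists 1%N, (fun=> a), (fun=> b); split=> //.
by rewrite big_ord_recl big_ord0 addr0.
Qed.

Hypothesis hsp : semiprime_ring R.

(** Semiprimeness only speaks of two-sided ideals.  The intersection of l(J) with
the right annihilator of l(J) is a two-sided ideal of square zero, and it
contains any left ideal J of square zero. *)
Lemma semiprime_left_ideal (J : set R^o) : submodule J ->
  (forall x y : R, J x -> J y -> x * y = 0) -> J `<=` [set 0].
Proof.
move=> hJ JJ.
pose lJ := left_annihilator (J : set R).
have lJ2 : two_sided_ideal lJ.
  by apply: left_annihilator_ideal => r x; apply: (submodZ hJ r).
pose A : set R := lJ `&` [set x | forall r, lJ r -> r * x = 0].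
have hA : two_sided_ideal A.
  split; last first.
    move=> a r [la ra]; split; first exact: (ideal_mulr lJ2).
    by move=> s ls; rewrite mulrA ra ?mul0r.
  apply: submoduleI; first by case: lJ2.
  apply/submoduleP; split=> [r _|a x y x0 y0 r lr]; first by rewrite mulr0.
  rewrite mulrDr -[_ *: _]/(a * x) mulrA x0 ?y0 ?addr0 //.
  exact: (ideal_mulr lJ2).
case: hsp => _ /(_ A hA) A0 x Jx; apply: A0; last first.
  by split=> [y Jy|r lr]; [exact: JJ|exact: lr].
apply: ideal_mul_sub; last by move=> a b [la _] [_ rb]; exact: rb.
by apply/submoduleP; split=> // a b c -> ->; rewrite /= scaler0 addr0.
Qed.

Lemma semiprime_elem (a : R) : (forall r, a * r * a = 0) -> a = 0.
Proof.
move=> aRa; apply: (@semiprime_left_ideal (multiples (a : R^o))).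
- exact: submodule_multiples.
- move=> _ _ [r _ <-] [s _ <-].
  by rewrite -[r *: _]/(r * a) -[s *: _]/(s * a) mulrA -!(mulrA r) aRa mulr0.
- exact: multiples_id.
Qed.

(** For x nonzero, either some i x with i in I is nonzero and lies in I, or
I x = 0; in the latter case (x i) R (x i) = 0 for all i in I, so x lies in
l(I). *)
Lemma ideal_add_annihilator_essential I : two_sided_ideal I ->
  essential (pair_sum (I : set R^o) (left_annihilator I : set R^o)).
Proof.
move=> hI; have [hl _] := hI.
have lI : two_sided_ideal (left_annihilator I).
  by apply: left_annihilator_ideal => r x; apply: (ideal_mull hI).
apply/essentialP; split; first by apply: submodule_pair_sum => //; case: lI.
move=> x nx; have [[i Ii nix]|h] := pselect (exists2 i, I i & i * x != 0).
  exists i => //; exists (i * x); first exact: (ideal_mulr hI).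
  by rewrite -[i *: x]/(i * x) subrr; apply: submod0; case: lI.
have Ix i : I i -> i * x = 0.
  by move=> Ii; apply: contrapT => /eqP nix; apply: h; exists i.
exists 1; rewrite ?scale1r //; exists 0; first exact: (submod0 hl).
rewrite subr0 => i Ii; apply: semiprime_elem => r.
have irx : i * r * x = 0 by apply/Ix/(ideal_mulr hI).
by rewrite mulrA -(mulrA x i r) -(mulrA x _ x) irx mulr0 mul0r.
Qed.

(** If i e were nonzero, some u = s i e would be a nonzero element of V.  It is
killed by I, as an element of V, and by l(I), because s i lies in I; so its
annihilator is essential. *)
Lemma essential_annihilator_sub M (V : set M) I :
  nonsingular M -> two_sided_ideal I -> essential V ->
  (forall r v, I r -> V v -> r *: v = 0) -> I `<=` module_annihilator M.
Proof.
move=> /nonsingularP nsM hI /essentialP[_ eV] IV i Ii e.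
apply: contrapT => /eqP /eV[s Vu /eqP[]].
apply: (nsM _ _ (ideal_add_annihilator_essential hI)) => r [j Ij lrj].
rewrite -[r](addrNK j) scalerDl (IV j) // addr0.
by rewrite !scalerA -mulrA lrj ?scale0r //; apply: (ideal_mull hI).
Qed.

(** Prime: if A B kills E and B does not, then the elements killed by A form a
nonzero, hence essential, submodule, and A kills E.  Minimal: if a prime Q inside
P = Ann E does not contain P, it contains l(P), since l(P) P = 0; then l(P) has
square zero, so it vanishes and P = P + l(P) is essential. *)
Lemma annihilator_minimal_prime E :
  indecomposable_nonsingular_injective E ->
  minimal_prime_ideal (module_annihilator E).
Proof.
move=> iE; have [[[x nx] _] nsE _] := iE.
set P := module_annihilator E.
have hP : two_sided_ideal P by apply: two_sided_ideal_annihilator.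
split; first split=> //.
- apply/eqP => PT; case/eqP: nx; rewrite -[x]scale1r.
  by have : P 1 by rewrite PT.
- move=> A B hA hB AB; have [BP|/existsNP[b /not_implyP[Bb nb]]] :=
    pselect (B `<=` P).
    by right.
  left; pose V : set E := [set y | forall a, A a -> a *: y = 0].
  have hV : submodule V.
    apply/submoduleP; split=> [a _|r u v Vu Vv a Aa]; first exact: scaler0.
    by rewrite scalerDr Vv // addr0 scalerA Vu //; apply: (ideal_mulr hA).
  apply: (@essential_annihilator_sub _ V) => //; last by move=> r v Ar; exact.
  apply: indecomposable_injective_essential => //; split=> //.
  have [y /eqP ny] : exists y : E, b *: y <> 0 by apply/existsNP.
  apply/(submod_neq0P hV); exists (b *: y) => // a Aa.
  by rewrite scalerA; apply: (AB); apply: ideal_mul_mem.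
- move=> Q [hQ _ primeQ] QP; have [hl _] := hP.
  have lP : two_sided_ideal (left_annihilator P).
    by apply: left_annihilator_ideal => r a; apply: (ideal_mull hP).
  case: (primeQ _ _ lP hP) => [||PQ].
  + apply: ideal_mul_sub => [|a b lPa Pb]; first by case: hQ.
    by rewrite lPa //; apply: (@submod0 _ R^o); case: hQ.
  + move=> lPQ; case/eqP: nx.
    have lP0 : left_annihilator P `<=` [set 0].
      apply: semiprime_left_ideal; first by case: lP.
      by move=> a b la lb; apply/la/QP/lPQ.
    move/nonsingularP: nsE; apply; first exact: (ideal_add_annihilator_essential hP).
    by move=> r [p Pp /lP0/subr0_eq ->]; apply: Pp.
  + by apply/seteqP.
Qed.

(** By induction on n: the product of J 0 with the intersection of the others
lies in all the J i. *)
Lemma prime_avoids_intersection n (J : 'I_n -> set R) P :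
  prime_ideal P -> (forall i, two_sided_ideal (J i)) ->
  (forall r, (forall i, J i r) -> P r) -> exists i, J i `<=` P.
Proof.
move=> [hP nPT primeP]; elim: n J => [|n IHn] J hJ JP.
  by case/eqP: nPT; apply/seteqP; split=> // r _; apply: JP => -[].
pose K : set R := [set r | forall i, J (lift ord0 i) r].
have hK : two_sided_ideal K.
  split; last by move=> a r Ka i; apply: (ideal_mulr (hJ _)).
  apply/submoduleP; split=> [i|a x y Kx Ky i].
    by apply: submod0; case: (hJ (lift ord0 i)).
  by case: (hJ (lift ord0 i)) => /submoduleP[_ h] _; apply: h.
case: (primeP _ _ (hJ ord0) hK) => [|J0P|KP].
- apply: ideal_mul_sub => [|a b Ja Kb]; first by case: hP.
  apply: JP => i; case: (unliftP ord0 i) => [j ->|->].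
    exact: (ideal_mull (hJ _)).
  exact: (ideal_mulr (hJ _)).
- by exists ord0.
- by have [i Ji] := IHn _ (fun i => hJ (lift ord0 i)) KP; exists (lift ord0 i).
Qed.

(** If a is nonzero with essential left annihilator, pick r with a r a nonzero.
Then l(a r a) is essential and strictly larger than l(a): as l(r a) is essential,
some s with s a nonzero satisfies s a r a = 0.  Iterating contradicts the
ascending chain condition. *)
Lemma acc_semiprime_nonsingular : acc_left_annihilators R -> nonsingular R^o.
Proof.
move=> acc; apply/nonsingularP => L z0 eL Lz0.
apply: contrapT => /eqP nz0.
pose Z (a : R) := essential (annihilator (a : R^o)) /\ a != 0.
pose above (a c : R) : Prop := [/\ Z c, (forall r, r * a = 0 -> r * c = 0) &
  exists2 r, r * a != 0 & r * c = 0].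
have [next nextP] : {next : R -> R & forall a : R, Z a -> above a (next a)}.
  apply: (@choice _ _ (fun a c => Z a -> above a c)) => a.
  have [[ea na]|nZ] := pselect (Z a); last by exists 0.
  have [r nara] : exists r, a * r * a != 0.
    apply: contrapT => h; case/eqP: na; apply: semiprime_elem => r.
    by apply: contrapT => /eqP nr; apply: h; exists r.
  exists (a * r * a) => _; split; first split=> //.
  - apply: essential_sub (essential_colon (a * r : R^o) ea).
      exact: submodule_annihilator.
    by move=> s sara; rewrite /annihilator /= -[RHS]sara; apply: (mulrA s).
  - by move=> s sa; rewrite !mulrA sa !mul0r.
  - have /essentialP[_ /(_ a na)[s sa nsa]] := essential_colon (r : R^o) ea.
    exists s => //; rewrite -[RHS]sa !mulrA; apply: esym.
    by rewrite -[LHS]/(s * a * r * a).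
pose a n := iter n next z0.
have aZ n : Z (a n).
  elim: n => [|n /nextP[]//]; split=> //.
  by apply: essential_sub eL => //; exact: submodule_annihilator.
have [||N NP] := acc (fun n => left_annihilator [set a n]).
- by move=> n; exists [set a n].
- move=> n r ra _ ->; have [_ sub _] := nextP _ (aZ n).
  by apply: sub; exact: ra.
- have [_ _ [r /eqP nra rna]] := nextP _ (aZ N); apply: nra.
  have : left_annihilator [set a N.+1] r by move=> _ ->.
  by rewrite NP //; apply.
Qed.

End SemiprimeRings.

(** * Injective hulls of nonsingular modules *)

Section Germs.
Variables (R : pzRingType) (M : lmodType R).
Implicit Types f g h : R -> M.

Definition is_germ f : Prop :=
  exists2 L : set R^o, essential L & linear_on L (f : R^o -> M).

Definition germ_eq f g : Prop :=
  exists2 L : set R^o, essential L & forall r : R, L r -> f r = g r.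

Lemma germ_eq_refl f : germ_eq f f.
Proof. by exists [set: R^o] => //; apply: essential_setT. Qed.

Lemma germ_eq_sym f g : germ_eq f g -> germ_eq g f.
Proof. by case=> L eL fg; exists L => // r /fg. Qed.

Lemma germ_eq_trans f g h : germ_eq f g -> germ_eq g h -> germ_eq f h.
Proof.
move=> [L eL fg] [L' eL' gh]; exists (L `&` L'); first exact: essentialI.
by move=> r [/fg -> /gh].
Qed.

Lemma germ_eq_germ f g : germ_eq f g -> is_germ f -> is_germ g.
Proof.
move=> [L eL fg] [L' eL' lf]; exists (L `&` L'); first exact: essentialI.
move=> a x y [Lx L'x] [Ly L'y]; rewrite -!fg // ?lf //.
by case: eL => /submoduleP[_ hL] _; apply: hL.
Qed.

(** A representative depending only on the class of f, so that germs can be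
taken to be the functions that represent their own class. *)
Definition germ_rep f : R -> M := xget (fun=> 0) (germ_eq f).

Lemma germ_repP f : germ_eq f (germ_rep f).
Proof. by apply: (@xgetPex _ _ (germ_eq f)); exists f; apply: germ_eq_refl. Qed.

Lemma germ_rep_eq f g : germ_eq f g -> germ_rep f = germ_rep g.
Proof.
move=> fg; congr (xget _ _); apply/seteqP; split=> h.
  by apply: germ_eq_trans; apply: germ_eq_sym.
exact: germ_eq_trans.
Qed.

Record germ : Type := Germ {
  germ_fun : R -> M;
  germ_funP : is_germ germ_fun /\ germ_rep germ_fun = germ_fun }.
HB.instance Definition _ := gen_eqMixin germ.
HB.instance Definition _ := gen_choiceMixin germ.

Lemma germ_valP (q : germ) : is_germ (germ_fun q).
Proof. by case: (germ_funP q). Qed.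

Lemma germ_ext (p q : germ) : germ_eq (germ_fun p) (germ_fun q) -> p = q.
Proof.
case: p q => [f hf] [g hg] /= /germ_rep_eq.
rewrite (proj2 hf) (proj2 hg) => fg.
by rewrite {}fg in hf *; congr Germ; apply: Prop_irrelevance.
Qed.

Lemma mk_germ_subproof f : is_germ f ->
  is_germ (germ_rep f) /\ germ_rep (germ_rep f) = germ_rep f.
Proof.
move=> gf; split; first exact: germ_eq_germ (germ_repP f) gf.
by apply: germ_rep_eq; apply: germ_eq_sym; apply: germ_repP.
Qed.

Definition mk_germ f (gf : is_germ f) : germ := Germ (mk_germ_subproof gf).

Lemma val_mk_germ f (gf : is_germ f) : germ_eq (germ_fun (mk_germ gf)) f.
Proof. exact/germ_eq_sym/germ_repP. Qed.

Lemma is_germ_add f g : is_germ f -> is_germ g -> is_germ (fun x => f x + g x).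
Proof.
move=> [L eL lf] [L' eL' lg]; exists (L `&` L'); first exact: essentialI.
by move=> a x y [Lx L'x] [Ly L'y]; rewrite lf // lg // scalerDr addrACA.
Qed.

Lemma is_germ_opp f : is_germ f -> is_germ (fun x => - f x).
Proof.
move=> [L eL lf]; exists L => // a x y Lx Ly.
by rewrite lf // opprD scalerN.
Qed.

(** The scalar r acts by f |-> f (_ * r), with domain (L : r) when f is linear
on L. *)
Lemma is_germ_act r f : is_germ f -> is_germ (fun x => f (x * r)).
Proof.
move=> [L eL lf]; exists (colon L (r : R^o)); first exact: essential_colon.
move=> a x y Lx Ly; rewrite -lf //; congr f.
by rewrite mulrDl -[a *: (x : R^o)]/(a * x) -mulrA.
Qed.

Lemma is_germ_mulr m : is_germ (fun x => x *: m).
Proof.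
exists [set: R^o]; first exact: essential_setT.
by move=> a x y _ _; rewrite scalerDl -scalerA.
Qed.

Lemma is_germ0 : is_germ (fun=> 0).
Proof.
exists [set: R^o]; first exact: essential_setT.
by move=> a x y _ _; rewrite scaler0 addr0.
Qed.

Lemma germ_eq_add f f' g g' : germ_eq f f' -> germ_eq g g' ->
  germ_eq (fun x => f x + g x) (fun x => f' x + g' x).
Proof.
move=> [L eL ff] [L' eL' gg]; exists (L `&` L'); first exact: essentialI.
by move=> r [/ff -> /gg ->].
Qed.

Lemma germ_eq_act r f g : germ_eq f g ->
  germ_eq (fun x => f (x * r)) (fun x => g (x * r)).
Proof.
move=> [L eL fg]; exists (colon L (r : R^o)); first exact: essential_colon.
by move=> s Ls; apply: fg.
Qed.

Definition germ0 : germ := mk_germ is_germ0.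
Definition germ_opp (p : germ) := mk_germ (is_germ_opp (germ_valP p)).
Definition germ_add (p q : germ) :=
  mk_germ (is_germ_add (germ_valP p) (germ_valP q)).
Definition germ_scale r (p : germ) := mk_germ (is_germ_act r (germ_valP p)).

Lemma val_germ_add p q :
  germ_eq (germ_fun (germ_add p q)) (fun x => germ_fun p x + germ_fun q x).
Proof. exact: val_mk_germ. Qed.

Lemma val_germ_scale r p :
  germ_eq (germ_fun (germ_scale r p)) (fun x => germ_fun p (x * r)).
Proof. exact: val_mk_germ. Qed.

Lemma germ_addA : associative germ_add.
Proof.
move=> p q s; apply: germ_ext.
apply: germ_eq_trans (val_germ_add _ _) _.
apply: germ_eq_trans (germ_eq_add (germ_eq_refl _) (val_germ_add _ _)) _.
apply/germ_eq_sym; apply: germ_eq_trans (val_germ_add _ _) _.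
apply: germ_eq_trans (germ_eq_add (val_germ_add _ _) (germ_eq_refl _)) _.
rewrite (_ : (fun x => _) =
    (fun x => germ_fun p x + (germ_fun q x + germ_fun s x))).
  exact: germ_eq_refl.
by apply/funext => x; rewrite addrA.
Qed.

Lemma germ_addC : commutative germ_add.
Proof.
move=> p q; apply: germ_ext.
apply: germ_eq_trans (val_germ_add _ _) _; apply/germ_eq_sym.
apply: germ_eq_trans (val_germ_add _ _) _.
by rewrite (_ : (fun x => _) = (fun x => germ_fun p x + germ_fun q x));
  [exact: germ_eq_refl|apply/funext => x; rewrite addrC].
Qed.

Lemma germ_add0 : left_id germ0 germ_add.
Proof.
move=> p; apply: germ_ext; apply: germ_eq_trans (val_germ_add _ _) _.
apply: germ_eq_trans (germ_eq_add (val_mk_germ _) (germ_eq_refl _)) _.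
by rewrite (_ : (fun x => _) = germ_fun p);
  [exact: germ_eq_refl|apply/funext => x; rewrite add0r].
Qed.

Lemma germ_addN : left_inverse germ0 germ_opp germ_add.
Proof.
move=> p; apply: germ_ext; apply: germ_eq_trans (val_germ_add _ _) _.
apply: germ_eq_trans (germ_eq_add (val_mk_germ _) (germ_eq_refl _)) _.
apply/germ_eq_sym; apply: germ_eq_trans (val_mk_germ _) _.
by rewrite (_ : (fun x => _ + _) = (fun=> 0));
  [exact: germ_eq_refl|apply/funext => x; rewrite addNr].
Qed.

HB.instance Definition _ :=
  GRing.isZmodule.Build germ germ_addA germ_addC germ_add0 germ_addN.

Lemma germ_scaleA a b p :
  germ_scale a (germ_scale b p) = germ_scale (a * b) p.
Proof.
apply: germ_ext; apply: germ_eq_trans (val_germ_scale _ _) _.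
apply: germ_eq_trans (germ_eq_act _ (val_germ_scale _ _)) _.
apply/germ_eq_sym; apply: germ_eq_trans (val_germ_scale _ _) _.
by rewrite (_ : (fun x => _) = (fun x => germ_fun p (x * a * b)));
  [exact: germ_eq_refl|apply/funext => x; rewrite mulrA].
Qed.

Lemma germ_scale1 : left_id 1 germ_scale.
Proof.
move=> p; apply: germ_ext; apply: germ_eq_trans (val_germ_scale _ _) _.
by rewrite (_ : (fun x => _) = germ_fun p);
  [exact: germ_eq_refl|apply/funext => x; rewrite mulr1].
Qed.

Lemma germ_scaleDr : right_distributive germ_scale +%R.
Proof.
move=> a p q; apply: germ_ext; apply: germ_eq_trans (val_germ_scale _ _) _.
apply: germ_eq_trans (germ_eq_act _ (val_germ_add _ _)) _.
apply/germ_eq_sym; apply: germ_eq_trans (val_germ_add _ _) _.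
exact: germ_eq_add (val_germ_scale _ _) (val_germ_scale _ _).
Qed.

(** Here linearity of the germ is needed, so the law holds only on
the intersection of (L : a) and (L : b), where x a and x b lie in the domain L. *)
Lemma germ_scaleDl p : {morph germ_scale^~ p : a b / a + b >-> a + b}.
Proof.
move=> a b; apply: germ_ext; apply: germ_eq_trans (val_germ_scale _ _) _.
apply/germ_eq_sym; apply: germ_eq_trans (val_germ_add _ _) _.
apply: germ_eq_trans (germ_eq_add (val_germ_scale _ _) (val_germ_scale _ _)) _.
have [L eL lp] := germ_valP p.
exists (colon L (a : R^o) `&` colon L (b : R^o)).
  by apply: essentialI; apply: essential_colon.
move=> r [La Lb]; rewrite mulrDr -[r * a]mul1r.
by rewrite -[1 * _]/(1 *: (r * a : R^o)) lp // !scale1r.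
Qed.

HB.instance Definition _ := GRing.Zmodule_isLmodule.Build R germ
  germ_scaleA germ_scale1 germ_scaleDr germ_scaleDl.

Lemma val_germD p q :
  germ_eq (germ_fun (p + q)) (fun x => germ_fun p x + germ_fun q x).
Proof. exact: val_germ_add. Qed.

Lemma val_germZ r p : germ_eq (germ_fun (r *: p)) (fun x => germ_fun p (x * r)).
Proof. exact: val_germ_scale. Qed.

Lemma val_germ0 : germ_eq (germ_fun (0 : germ)) (fun=> 0).
Proof. exact: val_mk_germ. Qed.

Definition const_germ m : germ := mk_germ (is_germ_mulr m).

Lemma val_const_germ m : germ_eq (germ_fun (const_germ m)) (fun x => x *: m).
Proof. exact: val_mk_germ. Qed.

Lemma const_germ_linear : linear const_germ.
Proof.
move=> a x y; apply: germ_ext; apply: germ_eq_trans (val_const_germ _) _.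
apply/germ_eq_sym; apply: germ_eq_trans (val_germD _ _) _.
apply: germ_eq_trans (germ_eq_add _ (val_const_germ _)) _.
  exact: germ_eq_trans (val_germZ _ _) (germ_eq_act _ (val_const_germ _)).
rewrite (_ : (fun r => _) = (fun r => r *: (a *: x + y))).
  exact: germ_eq_refl.
by apply/funext => r; rewrite scalerDr scalerA.
Qed.

HB.instance Definition _ :=
  GRing.isLinear.Build R M germ *:%R const_germ const_germ_linear.

(** Multiplying a germ by an element of its domain gives the constant germ of its
value there; this is why M is essential among germs and why germs are
nonsingular. *)
Lemma germ_eval (q : germ) : exists2 L : set R^o, essential L &
  linear_on L (germ_fun q : R^o -> M) /\
  forall r : R, L r -> r *: q = const_germ (germ_fun q r).
Proof.
have [L eL lq] := germ_valP q; exists L => //; split=> // r Lr.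
apply: germ_ext; apply: germ_eq_trans (val_germZ _ _) _.
apply/germ_eq_sym; apply: germ_eq_trans (val_const_germ _) _.
have lq0 : germ_fun q 0 = 0.
  have := lq (-1) r r Lr Lr.
  by rewrite !scaleN1r !addNr.
exists [set: R^o]; first exact: essential_setT.
move=> s _; rewrite -[s * r]addr0.
rewrite -[s * r]/(s *: (r : R^o)) lq //; last exact: (submod0 (proj1 eL)).
by rewrite lq0 addr0.
Qed.

Hypothesis nsM : nonsingular M.

Lemma const_germ_inj : injective const_germ.
Proof.
move=> x y xy.
have [L eL Lxy] : germ_eq (fun r => r *: x) (fun r => r *: y).
  apply: germ_eq_trans (germ_eq_sym (val_const_germ _)) _.
  by rewrite xy; apply: val_const_germ.
exact: nonsingular_eq eL Lxy.
Qed.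

Lemma essential_const_germ : essential (range const_germ).
Proof.
apply/essentialP; split.
  apply/submoduleP; split; first by exists 0; rewrite ?linear0.
  by move=> a _ _ [x _ <-] [y _ <-]; exists (a *: x + y); rewrite ?linearP.
move=> q nq; have [L eL [_ qL]] := germ_eval q.
apply: contrapT => h; case/eqP: nq; apply: germ_ext.
apply: germ_eq_trans (germ_eq_sym val_germ0); exists L => // r Lr.
apply: const_germ_inj; rewrite -qL // linear0.
apply: contrapT => /eqP nr; apply: h; exists r => //.
by rewrite qL //; exists (germ_fun q r).
Qed.

Lemma nonsingular_germ : nonsingular (germ : lmodType R).
Proof.
apply/nonsingularP => L q eL Lq; apply: germ_ext.
apply: germ_eq_trans (germ_eq_sym val_germ0).
have [L' eL' [_ qL]] := germ_eval q.
exists (L `&` L'); first exact: essentialI.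
by move=> r [Lr L'r]; apply: const_germ_inj; rewrite -qL // Lq // linear0.
Qed.

Hypothesis nsR : nonsingular R^o.

(** Given phi from an essential left ideal J to the germs, the r in J for which
phi r is a constant germ form a left ideal L, essential because the constant
germs are essential and R is nonsingular.  On L, phi comes from a linear map
c to M, whose germ q satisfies r q = phi r for r in J, as can be checked after
multiplication by the essential left ideal (L : r). *)
Lemma injective_germ : injective_module (germ : lmodType R).
Proof.
apply: nonsingular_injective_criterion; first exact: nonsingular_germ.
move=> J phi eJ lphi; have [hJ _] := eJ.
pose L : set R^o := [set r | J r /\ range const_germ (phi r)].
have [hC _] := essential_const_germ.
have phi0 : phi 0 = 0.
  have := lphi (-1) 0 0 (submod0 hJ) (submod0 hJ).
  by rewrite scaler0 addr0 scaleN1r addNr.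
have phiZ (s r : R) : J r -> phi (s * r) = s *: phi r.
  move=> Jr; rewrite -[RHS]addr0 -phi0 -lphi //; last exact: (submod0 hJ).
  by rewrite addr0.
have hL : submodule L.
  apply/submoduleP; split.
    by split; [exact: (submod0 hJ)|rewrite phi0; exact: (submod0 hC)].
  move=> a x y [Jx cx] [Jy cy]; split; first by case/submoduleP: hJ => _; apply.
  by rewrite lphi //; case/submoduleP: hC => _; apply.
have eLr (r : R) : J r -> essential (colon L (r : R^o)).
  move=> Jr; apply: essential_sub (essential_colon (phi r) essential_const_germ).
    exact: submodule_colon.
  move=> s cs; split; first exact: (submodZ hJ).
  by rewrite -[s *: (r : R^o)]/(s * r) phiZ.
have eL : essential L.
  apply/essentialP; split=> // x nx.
  have /essentialP[_ /(_ x nx)[r Jrx nrx]] := eJ.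
  apply: contrapT => h; case/eqP: nrx; move/nonsingularP: nsR; apply.
    exact: (eLr (r *: x)).
  move=> s Ls; apply: contrapT => /eqP ns; apply: h.
  by exists (s * r); rewrite -scalerA.
have [c cE] : {c : R -> M & forall r : R, L r -> const_germ (c r) = phi r}.
  apply: (@choice _ _ (fun r m => L r -> const_germ m = phi r)) => r.
  by have [[_ [m _ <-]]|nL] := pselect (L r); [exists m|exists 0].
have gc : is_germ c.
  exists L => // a x y Lx Ly; apply: const_germ_inj.
  have Laxy : L (a *: x + y) by case/submoduleP: hL => _; apply.
  by rewrite linearP /= !cE // lphi //; [case: Lx|case: Ly].
exists (mk_germ gc) => r Jr.
have [L' eL' Lc] : germ_eq (germ_fun (mk_germ gc)) c by apply: val_mk_germ.
have [L2 eL2 [_ L2c]] := germ_eval (mk_germ gc).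
apply: (nonsingular_eq nonsingular_germ
  (essentialI (eLr _ Jr) (essential_colon (r : R^o) (essentialI eL' eL2)))).
move=> s [Ls [L's L2s]]; rewrite scalerA -phiZ // L2c // Lc //.
by rewrite cE.
Qed.

End Germs.

Lemma nonsingular_injective_hull (R : pzRingType) (M : lmodType R) :
  nonsingular R^o -> nonsingular M ->
  exists (E : lmodType R) (i : {linear M -> E}),
    [/\ injective i, essential (range i), nonsingular E & injective_module E].
Proof.
move=> nsR nsM; exists (germ M : lmodType R), (@const_germ R M).
split; [exact: const_germ_inj|exact: essential_const_germ|
  exact: nonsingular_germ|exact: injective_germ].
Qed.

(** * Minimal primes as annihilators *)

Section Correspondence.
Variable R : pzRingType.

(** Two nonzero submodules of the hull meet U in nonzero left ideals, which meet
each other as U is uniform. *)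
Lemma uniform_left_ideal_hull (U : set R^o) :
  nonsingular R^o -> uniform_submodule U ->
  exists E : lmodType R, indecomposable_nonsingular_injective E /\
    (forall r u : R, module_annihilator E r -> U u -> r * u = 0).
Proof.
move=> nsR [[hU nU] unifU].
have [M [j [jinj jU]]] := submodule_as_module hU.
have nsM := nonsingular_inj jinj nsR.
have [E [i [iinj /essentialP[_ eI] nsE injE]]] :=
  nonsingular_injective_hull nsR nsM.
have UjE m : U (j m) by rewrite -jU; exists m.
exists E; split; last first.
  move=> r u rE; rewrite -jU => -[m _ <-].
  have rm : r *: m = 0 by apply: iinj; rewrite linearZ linear0; apply: rE.
  by rewrite -[r * j m]/(r *: j m) -linearZ /= rm linear0.
split=> //; split.
  have [u Uu nu] := (submod_neq0P hU).1 nU.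
  move: Uu; rewrite -jU => -[m _ mu]; exists (i m).
  apply: contra_neq nu => im0; rewrite -mu.
  by have -> : m = 0; [apply: iinj; rewrite im0 linear0|rewrite linear0].
move=> A B hA hB AB0 _; apply: contrapT => /not_orP[/eqP nA /eqP nB].
pose trace (C : set E) : set R^o := j @` [set m | C (i m)].
have htrace C : submodule C -> submodule (trace C).
  move=> hC; apply/submoduleP; split.
    by exists 0; rewrite /= ?linear0 //; exact: (submod0 hC).
  move=> a _ _ [x Cx <-] [y Cy <-]; exists (a *: x + y); last by rewrite linearP.
  by rewrite /= linearP; case/submoduleP: hC => _; apply.
have ntrace C : submodule C -> C != [set 0] -> nonzero_submodule (trace C).
  move=> hC /(submod_neq0P hC)[x Cx /eI[r [m _ rm] nrx]].
  split; first exact: htrace.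
  apply/(submod_neq0P (htrace _ hC)); exists (j m).
    by exists m => //=; rewrite rm; apply: submodZ.
  apply: contra_neq nrx => jm0; rewrite -rm.
  by have -> : m = 0; [apply: jinj; rewrite jm0 linear0|rewrite linear0].
have traceU C : trace C `<=` U by move=> _ [m _ <-].
have := unifU _ _ (ntrace _ hA nA) (ntrace _ hB nB) (traceU A) (traceU B).
case/(submod_neq0P (submoduleI (htrace _ hA) (htrace _ hB))).
move=> x [[m Am mx] [m' Bm m'x]] /eqP; apply; rewrite -mx.
have mm' : m = m' by apply: jinj; rewrite mx.
have : [set 0] (i m) by rewrite -AB0; split; rewrite // mm'.
by rewrite -(linear0 i) => /iinj ->; rewrite linear0.
Qed.

Hypothesis hsp : semiprime_ring R.
Hypothesis hG : left_Goldie R.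

Lemma minimal_prime_annihilator (P : set R) : minimal_prime_ideal P ->
  exists E : lmodType R, indecomposable_nonsingular_injective E /\
    module_annihilator E = P.
Proof.
move=> [primeP minP]; have [acc [n [U [unifU _ essU]]]] := hG.
have nsR := acc_semiprime_nonsingular hsp acc.
have [E EP] : {E : 'I_n -> lmodType R &
    forall i, indecomposable_nonsingular_injective (E i) /\
      (forall r u : R, module_annihilator (E i) r -> U i u -> r * u = 0)}.
  apply: (@choice _ _ (fun i (E : lmodType R) =>
    indecomposable_nonsingular_injective E /\
    (forall r u : R, module_annihilator E r -> U i u -> r * u = 0))) => i.
  exact: uniform_left_ideal_hull.
have [||i Pi] := prime_avoids_intersection
  (J := fun i => module_annihilator (E i)) primeP.
- by move=> i; apply: two_sided_ideal_annihilator.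
- move=> r rE; suff -> : r = 0 by apply: (@submod0 _ R^o); case: primeP => -[].
  (* The sum of the U i is a left ideal which r kills, and if r is nonzero it
     contains a nonzero s r; then (s r) t (s r) = 0 for all t,
     because t s r lies in the sum. *)
  have [hL eL] := (essentialP _).1 essU.
  have kill (l : R) : submodule_sum U l -> r * l = 0.
    move=> [u Uu ->]; rewrite mulr_sumr big1 // => i _.
    by case: (EP i) => _; apply.
  apply: contrapT => /eqP /eL[s Ls /eqP[]].
  apply: (semiprime_elem hsp) => t.
  rewrite -[s *: _]/(s * r) -!mulrA kill ?mulr0 //.
  exact: (submodZ hL t).
have [iE _] := EP i; exists (E i); split=> //.
by apply: minP => //; case: (annihilator_minimal_prime hsp iE).
Qed.

End Correspondence.

Theorem corollary2p15 (R : pzRingType) (hsp : semiprime_ring R)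
    (hG : left_Goldie R) :
  (exists (I : Type) (E : I -> lmodType R),
     complete_representatives (@indecomposable_nonsingular_injective R) E) /\
  (forall (I : Type) (E : I -> lmodType R),
     complete_representatives (@indecomposable_nonsingular_injective R) E ->
     exists f : I -> {P : set R | minimal_prime_ideal P}, bijective f).
Proof.
split.
  exists {P : set R | minimal_prime_ideal P}.
  have [E EP] : {E : {P : set R | minimal_prime_ideal P} -> lmodType R &
      forall P, indecomposable_nonsingular_injective (E P) /\
        module_annihilator (E P) = sval P}.
    apply: (@choice _ _ (fun (P : {P : set R | minimal_prime_ideal P})
      (E : lmodType R) => indecomposable_nonsingular_injective E /\
        module_annihilator E = sval P)) => -[P minP] /=.
    exact: minimal_prime_annihilator.
  exists E; split=> [P|P Q|M iM].
  - by case: (EP P).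
  - move=> /module_annihilator_iso; rewrite !(proj2 (EP _)) => PQ.
    by apply: eq_sig_hprop PQ => Q' p q; exact: Prop_irrelevance.
  - pose P : {P : set R | minimal_prime_ideal P} :=
      exist _ _ (annihilator_minimal_prime hsp iM).
    have [iE annE] := EP P; exists P.
    apply: (annihilator_sub_isomorphic iM iE).
    by rewrite annE.
move=> I E [CE isoE surjE].
pose f i : {P : set R | minimal_prime_ideal P} :=
  exist _ _ (annihilator_minimal_prime hsp (CE i)).
have finj i j : f i = f j -> i = j.
  move=> /(congr1 sval) /= fij; apply: isoE.
  by apply: annihilator_sub_isomorphic => //; rewrite fij.
have [g gP] : {g : {P : set R | minimal_prime_ideal P} -> I &
    forall P, f (g P) = P}.
  apply: (@choice _ _ (fun P i => f i = P)) => -[P minP].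
  have [M [iM MP]] := minimal_prime_annihilator hsp hG minP.
  have [i isoi] := surjE M iM; exists i.
  apply: eq_sig_hprop => [Q|] /=; first by move=> ? ?; exact: Prop_irrelevance.
  by rewrite -MP; apply/esym/module_annihilator_iso.
by exists f; exists g => [i|//]; apply: finj.
Qed.
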